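(* Let $V\subset\mathbb{R}^4$ be the (central) hypersurface with equation $x^8=(z_1^2+z_2^2)y^8$ in coordinates $(x,y,z_1,z_2)$. Then the ring $\mathcal{R}^0(V)$ of continuous rational functions on $V$ does not have the substitution property over $\mathbb{R}[V]$ along algebraic Puiseux arcs.
   Context: $\mathcal{R}^0(V)$: continuous (Euclidean) functions $V\to\mathbb{R}$ whose restriction to some non-empty Zariski open subset of $V$ is regular. $\mathbb{R}[[t^*]]_{\mathrm{alg}}$: Puiseux series $\sum_{i\ge0}a_it^{i/m}$ of non-negative order which are algebraic over $\mathbb{R}[t]$. Substitution along algebraic Puiseux arcs means: every $\mathbb{R}$-algebra homomorphism $\mathbb{R}[V]\to\mathbb{R}[[t^*]]_{\mathrm{alg}}$ admits one and only one extension to a homomorphism $\mathcal{R}^0(V)\to\mathbb{R}[[t^*]]_{\mathrm{alg}}$. *)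

(* Defs.v *)
From HB Require Import structures.
From mathcomp Require Import all_boot all_order all_algebra.
From mathcomp Require Import all_classical all_reals all_analysis.
From mathcomp Require mpoly.

Set Implicit Arguments.
Unset Strict Implicit.
Unset Printing Implicit Defensive.
Import Order.TTheory GRing.Theory Num.Theory.
Import numFieldNormedType.Exports.
Local Open Scope classical_set_scope.
Local Open Scope ring_scope.

Section Defs.
Variable R : realType.

(** Points of R^4, coordinates (x, y, z1, z2) = (v_0, v_1, v_2, v_3). *)
Definition pt := 'rV[R]_4.
Definition coords (v : pt) : 'I_4 -> R := fun i => v ord0 i.

Definition poly4 := mpoly.mpoly 4 R.
Definition pev (p : poly4) (v : pt) : R := mpoly.meval (coords v) p.

Definition Vset : set pt :=
  [set v | v ord0 (@Ordinal 4 0 isT) ^+ 8 =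
           (v ord0 (@Ordinal 4 2 isT) ^+ 2 + v ord0 (@Ordinal 4 3 isT) ^+ 2)
             * v ord0 (@Ordinal 4 1 isT) ^+ 8].

(** Real-valued functions on V are represented by functions on R^4;
    only their values on V matter. *)
Definition fnV := pt -> R.

Definition RV (f : fnV) : Prop := exists p : poly4, forall v, Vset v -> f v = pev p v.

Definition zariski_open_V (U : set pt) : Prop :=
  exists gs : seq poly4,
    U = [set v | Vset v /\ has (fun g => pev g v != 0) gs].

Definition regular_on (U : set pt) (f : fnV) : Prop :=
  exists p q : poly4, (forall v, U v -> pev q v != 0) /\
                      (forall v, U v -> f v = pev p v / pev q v).

Definition R0 (f : fnV) : Prop :=
  {within Vset, continuous f} /\
  exists U : set pt, zariski_open_V U /\ U !=set0 /\ regular_on U f.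

(** Puiseux series with real coefficients, as coefficient functions
    rat -> R  (s = sum_q s(q) t^q). *)
Definition series := rat -> R.

Definition ps_zero : series := fun _ => 0.
Definition ps_const (c : R) : series := fun q => if q == 0 then c else 0.
Definition ps_one : series := ps_const 1.
Definition ps_add (a b : series) : series := fun q => a q + b q.
Definition ps_scale (c : R) (a : series) : series := fun q => c * a q.
(** Cauchy product (a finite sum for Puiseux series of non-negative order). *)
Definition ps_mul (a b : series) : series :=
  fun q => \sum_(r \in [set: rat]) (a r * b (q - r)).

(** Puiseux series of non-negative order: sum_{i>=0} a_i t^{i/m}. *)
Definition is_puiseux (a : series) : Prop :=
  exists m : nat, (0 < m)%N /\
    forall q : rat, a q != 0 -> 0 <= q /\ denq (q * m%:R) = 1%Z.

Definition ps_of_poly (p : {poly R}) : series :=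
  fun q => if (denq q == 1%Z) && (0 <= numq q)%R then p`_(absz (numq q)) else 0.

Definition ps_horner (P : {poly {poly R}}) (s : series) : series :=
  foldr (fun c acc => ps_add (ps_of_poly c) (ps_mul acc s)) ps_zero (polyseq P).

Definition is_alg (s : series) : Prop :=
  exists P : {poly {poly R}}, P != 0 /\ ps_horner P s = ps_zero.

Definition in_Puis_alg (s : series) : Prop := is_puiseux s /\ is_alg s.

Definition is_hom_on (D : fnV -> Prop) (phi : fnV -> series) : Prop :=
  (forall f, D f -> in_Puis_alg (phi f)) /\
      (forall f g, D f -> D g -> (forall v, Vset v -> f v = g v) -> phi f = phi g) /\
      (forall f g, D f -> D g -> phi (fun v => f v + g v) = ps_add (phi f) (phi g)) /\
      (forall f g, D f -> D g -> phi (fun v => f v * g v) = ps_mul (phi f) (phi g)) /\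
      (forall c f, D f -> phi (fun v => c * f v) = ps_scale c (phi f)) /\
      phi (fun _ => 1) = ps_one.

Definition substitution_property : Prop :=
  forall phi, is_hom_on RV phi ->
    exists psi, [/\ is_hom_on R0 psi,
                    (forall f, RV f -> psi f = phi f) &
                    forall psi', is_hom_on R0 psi' ->
                      (forall f, RV f -> psi' f = phi f) ->
                      forall f, R0 f -> psi' f = psi f].

End Defs.

(* Main.v *)
Require Import Defs.
From mathcomp Require Import all_boot all_order all_algebra.
From mathcomp Require Import all_classical all_reals all_analysis.
From mathcomp Require Import ring lra.
From mathcomp Require mpoly.

(* Uniqueness of the extension fails for the arc x = y = 0, z = (t^2, 0).
   Write |z| = u^4 and x = u y on V, and let f be a continuous rational function
   on V. Pulled back along a polynomial map parametrizing V, f becomes a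
   continuous function F with F Q = P for polynomials P and Q <> 0, and powers
   of a variable can be cancelled from this identity by continuity; hence
   f(0,0,u^4,0) is a rational function of u without pole at 0. It is even in u,
   so f(0,0,t^2,0), t >= 0, is a rational function of t = u^2. Its expansion at
   t = 0, and that expansion with t replaced by -t, are two homomorphisms on
   R^0(V); they agree on polynomials, which only involve t^2, but not on
   x^2/y^2 = |z|^(1/2), which they send to t and -t. *)

Set Implicit Arguments.
Unset Strict Implicit.
Unset Printing Implicit Defensive.
Import Order.TTheory GRing.Theory Num.Theory.
Import numFieldNormedType.Exports.
Local Open Scope classical_set_scope.
Local Open Scope ring_scope.

(** * Evaluations of iterated polynomial rings and cancellation of a variable *)

Definition faithful (R : realType) (A : idomainType) (T : Type)
  (ev : T -> {rmorphism A -> R}) := forall a, (forall t, ev t a = 0) -> a = 0.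

Section EvX.
Variables (R : realType) (A : idomainType) (T : Type).
Variable ev : T -> {rmorphism A -> R}.

(** Iterated, this gives polynomials in several variables with the newest variable outermost, so
    that the variables can be eliminated one at a time. *)
Definition evX (ty : T * R) : {rmorphism {poly A} -> R} :=
  horner_eval ty.2 \o map_poly (ev ty.1).

Lemma evXE ty P : evX ty P = (map_poly (ev ty.1) P).[ty.2].
Proof. by []. Qed.

Lemma evXC ty c : evX ty c%:P = ev ty.1 c.
Proof. by rewrite evXE map_polyC /= hornerC. Qed.

Lemma evXX ty : evX ty 'X = ty.2.
Proof. by rewrite evXE map_polyX /= hornerX. Qed.

Lemma evX0 t P : evX (t, 0) P = ev t P.[0].
Proof. by rewrite evXE -(rmorph0 (ev t)) horner_map. Qed.

(** Otherwise 0, 1, ..., [size p] - 1 would be more roots than the degree allows. The half-line is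
    what identities along the arc provide. *)
Lemma poly_eq0_on_ge0 (p : {poly R}) : (forall t, 0 <= t -> p.[t] = 0) -> p = 0.
Proof.
move=> p0; apply/eqP; apply/negPn/negP => pn0.
have := max_poly_roots (rs := [seq i%:R | i <- iota 0 (size p)]) pn0.
rewrite size_map size_iota ltnn map_inj_uniq ?iota_uniq; last first.
  by move=> i j /eqP; rewrite eqr_nat => /eqP.
move=> h; suff: false by []; apply: h => //.
by apply/allP => _ /mapP[i _ ->]; rewrite rootE p0// ler0n.
Qed.

Lemma evX_faithful : faithful ev -> faithful evX.
Proof.
move=> fev P P0; apply/polyP => i; rewrite coef0; apply: fev => t.
have : map_poly (ev t) P = 0 by apply: poly_eq0_on_ge0 => y _; exact: (P0 (t, y)).
by move=> /(congr1 (fun p : {poly R} => p`_i)); rewrite coef_map coef0.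
Qed.

Lemma cvg_off0 (h : R -> R) :
  h y @[y --> 0] --> h 0 -> (forall y, y != 0 -> h y = 0) -> h 0 = 0.
Proof.
move=> ch h0.
have c1 : h y @[y --> 0^'] --> h 0 by exact: cvg_within_filter.
have c2 : h y @[y --> 0^'] --> (0 : R).
  apply: cvg_near_cst; near=> y; apply: h0.
  by near: y; exact: nbhs_dnbhs_neq.
exact: (cvg_unique _ c1 c2).
Unshelve. all: by end_near. Qed.

(* A common root y = 0 of P and Q can be divided out: F Q = P persists at
   y = 0 by continuity, and P(0) vanishes as soon as Q(0) does. *)
Lemma cancelX (F : T * R -> R) (P Q : {poly A}) : faithful ev ->
  (forall t, F (t, y) @[y --> 0] --> F (t, 0)) ->
  Q != 0 -> (forall ty, F ty * evX ty Q = evX ty P) ->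
  exists P' Q', Q'.[0] != 0 /\ forall ty, F ty * evX ty Q' = evX ty P'.
Proof.
move=> fev cF; have [n] := ubnP (size Q).
elim: n P Q => // n IH P Q sQ Q0 FQ.
have [Qz|Qz] := eqVneq Q.[0] 0; last by exists P, Q.
have Pz : P.[0] = 0.
  by apply: fev => t; rewrite -evX0 -FQ evX0 Qz rmorph0 mulr0.
have factX (S : {poly A}) : S.[0] = 0 -> exists S', S = S' * 'X.
  by move=> /eqP /factor_theorem[S' ->]; exists S'; rewrite polyC0 subr0.
have [Q' QE] := factX _ Qz; have [P' PE] := factX _ Pz.
have Q'0 : Q' != 0 by apply: contraNneq Q0 => Q'0; rewrite QE Q'0 mul0r.
apply: (IH P' Q') => //.
  by move: sQ; rewrite QE size_mulX.
move=> [t y]; apply/eqP; rewrite -subr_eq0; apply/eqP.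
have off z : z != 0 -> F (t, z) * evX (t, z) Q' - evX (t, z) P' = 0.
  move=> z0; apply/eqP; rewrite subr_eq0; apply/eqP; apply: (mulIf z0).
  have := FQ (t, z); rewrite QE PE 2!rmorphM (evXX (t, z)) /= => <-.
  by rewrite mulrA.
have [->|] := eqVneq y 0; last exact: off.
apply: (@cvg_off0 (fun z => F (t, z) * evX (t, z) Q' - evX (t, z) P')) => //.
by apply: cvgB; [apply: cvgM => //|]; exact: continuous_horner.
Qed.

(** Elimination of one variable: once the powers of y are cancelled, the denominator stays nonzero
    at y = 0. *)
Lemma restrict0 (F : T * R -> R) (P Q : {poly A}) : faithful ev ->
  (forall t, F (t, y) @[y --> 0] --> F (t, 0)) ->
  Q != 0 -> (forall ty, F ty * evX ty Q = evX ty P) ->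
  exists P' Q', Q' != 0 /\ forall t, F (t, 0) * ev t Q' = ev t P'.
Proof.
move=> fev cF Q0 FQ; have [P' [Q' [Q'0 FQ']]] := cancelX fev cF Q0 FQ.
by exists P'.[0], Q'.[0]; split=> // t; rewrite -!evX0.
Qed.

End EvX.

(** * Polynomial parametrization of V *)

(** Serves to pull polynomial functions back both along the parametrization of V and along the
    arc. *)
Lemma mpoly_subst (R : realType) (A : idomainType) (T : Type)
    (ev : T -> {rmorphism A -> R}) (k : R -> A) (n : nat) (a : 'I_n -> A)
    (p : mpoly.mpoly n R) :
  (forall t r, ev t (k r) = r) ->
  exists P, forall t, ev t P = mpoly.meval (fun i => ev t (a i)) p.
Proof.
move=> evk.
exists (\sum_(m <- mpoly.msupp p) k (mpoly.mcoeff m p) *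
   \prod_i a i ^+ mpoly.fun_of_multinom m i) => t.
rewrite mpoly.mevalE rmorph_sum; apply: eq_bigr => m _ /=.
rewrite rmorphM evk rmorph_prod; congr (_ * _).
by apply: eq_bigr => i _; rewrite rmorphXn.
Qed.

(* With w = a + ib and u = r |w|^2 these are x = u y and z = r^4 |w|^6 w^2, so
   that |z| = u^4; the map is onto V. *)
Definition cone_seq (A : idomainType) (r a b y : A) : seq A :=
  [:: r * (a ^+ 2 + b ^+ 2) * y; y;
      r ^+ 4 * (a ^+ 2 + b ^+ 2) ^+ 3 * (a ^+ 2 - b ^+ 2);
      r ^+ 4 * (a ^+ 2 + b ^+ 2) ^+ 3 * (2 * a * b)].

(** Lets the same formulas describe the parametrization over a polynomial ring and its real
    values. *)
Lemma rmorph_cone_seq (A B : idomainType) (h : {rmorphism A -> B}) r a b y i :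
  h (cone_seq r a b y)`_i = (cone_seq (h r) (h a) (h b) (h y))`_i.
Proof.
by case: i => [|[|[|[|i]]]];
  rewrite /= ?nth_nil ?rmorph0// !(rmorphM, rmorphXn, rmorphD, rmorphN, rmorph1).
Qed.

Section Rationality.
Variable R : realType.

Definition vec (x y z1 z2 : R) : pt R := \row_i [:: x; y; z1; z2]`_i.

Lemma vecE (v : pt R) : v = vec (v ord0 (@Ordinal 4 0 isT))
  (v ord0 (@Ordinal 4 1 isT)) (v ord0 (@Ordinal 4 2 isT)) (v ord0 (@Ordinal 4 3 isT)).
Proof.
apply/rowP => i; rewrite mxE.
by case: i => [[|[|[|[|//]]]] h] /=; congr (v _ _); exact: val_inj.
Qed.

Lemma Vset_vec x y z1 z2 :
  Vset (vec x y z1 z2) = (x ^+ 8 = (z1 ^+ 2 + z2 ^+ 2) * y ^+ 8).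
Proof. by rewrite /Vset /= !mxE. Qed.

Lemma cvg_vec (F : set_system R) (FF : Filter F) (x y z1 z2 : R -> R) a b c d :
  x t @[t --> F] --> a -> y t @[t --> F] --> b -> z1 t @[t --> F] --> c ->
  z2 t @[t --> F] --> d ->
  vec (x t) (y t) (z1 t) (z2 t) @[t --> F] --> vec a b c d.
Proof.
move=> xa yb z1c z2d B [P nP sPB].
suff : \forall t \near F, forall i, P ord0 i (vec (x t) (y t) (z1 t) (z2 t) ord0 i).
  by apply: filterS => t Pt; apply: sPB => i j; rewrite (ord1 i).
have cv i : vec (x t) (y t) (z1 t) (z2 t) ord0 i @[t --> F] --> vec a b c d ord0 i.
  rewrite mxE; under eq_fun do rewrite mxE.
  by case: i => [[|[|[|[|//]]]] h].
by apply: filter_forall => i; exact: (cv i _ (nP ord0 i)).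
Qed.

Lemma within_path (f : pt R -> R) (c : R -> pt R) : {within @Vset R, continuous f} ->
  (forall t, Vset (c t)) -> c t @[t --> 0] --> c 0 -> f (c t) @[t --> 0] --> f (c 0).
Proof.
move=> /subspace_continuousP cf Vc cc.
apply: cvg_trans (cf _ (Vc 0)) => B /= nB.
have : \forall t \near (0 : R), Vset (c t) -> B (f (c t)) by exact: (cc _ nB).
by apply: filterS => t; apply.
Qed.

Definition cone (r a b y : R) : pt R := \row_i (cone_seq r a b y)`_i.

Lemma coneE r a b y : cone r a b y =
  vec (r * (a ^+ 2 + b ^+ 2) * y) y
      (r ^+ 4 * (a ^+ 2 + b ^+ 2) ^+ 3 * (a ^+ 2 - b ^+ 2))
      (r ^+ 4 * (a ^+ 2 + b ^+ 2) ^+ 3 * (2 * a * b)).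
Proof. by []. Qed.

Lemma cone_V r a b y : Vset (cone r a b y).
Proof. rewrite coneE Vset_vec; ring. Qed.

Lemma cvg_cone (F : set_system R) (FF : Filter F) (r a b y : R -> R)
    (r0 a0 b0 y0 : R) :
  r t @[t --> F] --> r0 -> a t @[t --> F] --> a0 -> b t @[t --> F] --> b0 ->
  y t @[t --> F] --> y0 ->
  cone (r t) (a t) (b t) (y t) @[t --> F] --> cone r0 a0 b0 y0.
Proof.
move=> cr ca cb cy.
have X n (g : R -> R) (l : R) : g t @[t --> F] --> l -> g t ^+ n @[t --> F] --> l ^+ n.
  elim: n => [|n IH] gl; first exact: cvg_cst.
  under eq_fun do rewrite exprS.
  by rewrite exprS; apply: cvgM => //; exact: IH.
rewrite coneE; under eq_fun do rewrite coneE.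
have cN : a t ^+ 2 + b t ^+ 2 @[t --> F] --> a0 ^+ 2 + b0 ^+ 2.
  by apply: cvgD; exact: X.
have cM : r t ^+ 4 * (a t ^+ 2 + b t ^+ 2) ^+ 3 @[t --> F]
    --> r0 ^+ 4 * (a0 ^+ 2 + b0 ^+ 2) ^+ 3 by apply: cvgM; exact: X.
apply: cvg_vec => //.
- by apply: cvgM => //; exact: cvgM.
- by apply: cvgM => //; apply: cvgB; exact: X.
- by apply: cvgM => //; apply: cvgM => //; apply: cvgM => //; exact: cvg_cst.
Qed.

(** Take w = (|z| + z1) + i z2, which points along a square root of z: w^2 = 2 (|z| + z1) z and
    |w|^2 = 2 |z| (|z| + z1). Then r = u / |w|^2. *)
Lemma cone_surj v : Vset v -> exists r a b y, v = cone r a b y.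
Proof.
rewrite (vecE v) Vset_vec.
move: (v ord0 (@Ordinal 4 0 isT)) (v ord0 (@Ordinal 4 1 isT))
  (v ord0 (@Ordinal 4 2 isT)) (v ord0 (@Ordinal 4 3 isT)) => x y z1 z2 xyz.
set n := Num.sqrt (z1 ^+ 2 + z2 ^+ 2).
have n0 : 0 <= n by exact: sqrtr_ge0.
have n2 : n ^+ 2 = z1 ^+ 2 + z2 ^+ 2 by rewrite sqr_sqrtr// addr_ge0// sqr_ge0.
(* If y = 0 the equation forces x = 0, and u is the fourth root of |z|. Otherwise u = x / y: then
   u^8 = |z|^2, and both u^4 and |z| are non-negative. *)
have [u [ux u4]] : exists u, x = u * y /\ u ^+ 4 = n.
  have [y0|y0] := eqVneq y 0.
    exists (Num.sqrt (Num.sqrt n)); split.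
      move: xyz; rewrite y0 expr0n /= !mulr0 => /eqP.
      by rewrite expf_eq0 => /andP[_ /eqP].
    by rewrite (exprM _ 2 2) !sqr_sqrtr// sqrtr_ge0.
  exists (x / y); split; first by rewrite divfK.
  apply/eqP; rewrite -(@eqrXn2 _ 2)// ?exprn_even_ge0//.
  by rewrite -exprM n2 expr_div_n xyz mulfK// expf_neq0.
(* Here z = -|z| is a non-positive real and the formula for w degenerates; w = i serves instead. *)
have [nz|nz] := eqVneq (n + z1) 0.
  have z1E : z1 = - n by apply/eqP; rewrite -addr_eq0 addrC nz.
  have z2E : z2 = 0.
    by apply/eqP; rewrite -[_ == 0](expf_eq0 _ 2); apply/eqP; move: n2; rewrite z1E; lra.
  by exists u, 0, 1, y; rewrite coneE; congr vec; rewrite ?ux ?u4 ?z1E ?z2E; ring.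
have nn : n != 0.
  apply: contraNneq nz => nn; rewrite nn add0r -[_ == 0](expf_eq0 _ 2).
  have := n2; rewrite nn => n2'; have := sqr_ge0 z1; have := sqr_ge0 z2.
  by move=> *; apply/eqP; lra.
have dE : (n + z1) ^+ 2 + z2 ^+ 2 = 2 * n * (n + z1).
  have -> : z2 ^+ 2 = n ^+ 2 - z1 ^+ 2 by rewrite n2; ring.
  ring.
have eE : (n + z1) ^+ 2 - z2 ^+ 2 = 2 * z1 * (n + z1).
  have -> : z2 ^+ 2 = n ^+ 2 - z1 ^+ 2 by rewrite n2; ring.
  ring.
exists (u / (2 * n * (n + z1))), (n + z1), z2, y.
rewrite coneE dE eE expr_div_n u4; congr vec; rewrite ?ux; field; exact/andP.
Qed.

(** * Rationality of continuous rational functions along the arc *)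

(** The variables are r, a - 1, b, y, from the innermost polynomial ring to the outermost; [unit]
    indexes the one evaluation of constants. *)
Let T4 := (unit * R * R * R * R)%type.
Let ev0 (_ : unit) : {rmorphism R -> R} := idfun.
Let ev1 := evX ev0.
Let ev2 := evX ev1.
Let ev3 := evX ev2.
Let ev4 := evX ev3.

Let fev0 : faithful ev0.
Proof. by move=> a /(_ tt). Qed.
Let fev1 : faithful ev1 := evX_faithful fev0.
Let fev2 : faithful ev2 := evX_faithful fev1.
Let fev3 : faithful ev3 := evX_faithful fev2.

(* The second parameter is shifted so that each variable is eliminated at 0. *)
Let par (t : T4) : pt R := cone t.1.1.1.2 (1 + t.1.1.2) t.1.2 t.2.

Lemma pev_par (p : poly4 R) : exists P, forall t, ev4 t P = pev p (par t).
Proof.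
pose r := ('X%:P%:P%:P : {poly {poly {poly {poly R}}}}).
pose a := (1 + 'X%:P%:P : {poly {poly {poly {poly R}}}}).
pose b := ('X%:P : {poly {poly {poly {poly R}}}}).
pose y := ('X : {poly {poly {poly {poly R}}}}).
have evr t : ev4 t r = t.1.1.1.2 by rewrite !evXC evXX.
have eva t : ev4 t a = 1 + t.1.1.2 by rewrite rmorphD rmorph1 !evXC evXX.
have evb t : ev4 t b = t.1.2 by rewrite evXC evXX.
have evy t : ev4 t y = t.2 by rewrite evXX.
have evk t (c : R) : ev4 t c%:P%:P%:P%:P = c by rewrite !evXC.
have [P PE] := mpoly_subst (fun i : 'I_4 => (cone_seq r a b y)`_i) p evk.
exists P => t; rewrite PE; apply: mpoly.meval_eq => i.
by rewrite /coords mxE rmorph_cone_seq evr eva evb evy.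
Qed.

Lemma R0_rational (f : fnV R) : R0 f -> exists p q : {poly R}, q.[0] != 0 /\
  forall u, f (vec 0 0 (u ^+ 4) 0) * q.[u] = p.[u].
Proof.
move=> [cf [_ [[gs ->] [[v0 [Vv0 gs0]] [p [q [q0 fpq]]]]]]].
have /(has_nthP p)[i igs gv0] : has (fun g => pev g v0 != 0) gs := gs0.
pose g := nth p gs i.
have [G GE] := pev_par g; have [P PE] := pev_par p; have [Q QE] := pev_par q.
have parV t : Vset (par t) by exact: cone_V.
(* The factor [G] extends the identity from the open set to all parameters: where [g] vanishes, both
   sides are 0. *)
have FQ t : f (par t) * ev4 t (Q * G) = ev4 t (P * G).
  rewrite !rmorphM GE PE QE; have [->|gn0] := eqVneq (pev g (par t)) 0.
    by rewrite !mulr0.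
  have Ut : Vset (par t) /\ has (fun g => pev g (par t) != 0) gs.
    by split=> //; apply/(has_nthP p); exists i.
  by rewrite fpq// mulrA divfK// q0.
(* By surjectivity [v0] is a value of the parametrization, and neither [q] nor [g] vanishes
   there. *)
have QG0 : Q * G != 0.
  have [r [a [b [y v0E]]]] := cone_surj Vv0.
  have v0par : v0 = par (tt, r, a - 1, b, y) by rewrite v0E /par /= addrC subrK.
  apply: contraPneq isT => QG0.
  have := erefl (ev4 (tt, r, a - 1, b, y) (Q * G)).
  rewrite {2}QG0 rmorph0 rmorphM GE QE -v0par => /eqP.
  rewrite mulf_eq0 (negPf (gv0 : pev g v0 != 0)) (negPf (q0 v0 _)).
    by [].
  by split.
have cpar (c : R -> T4) : par (c t) @[t --> 0] --> par (c 0) ->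
    f (par (c t)) @[t --> 0] --> f (par (c 0))
  by exact: (within_path (c := par \o c) cf (fun t => parV _)).
(* The variables y, b and a - 1 are set to 0 in turn, which leaves the points (0, 0, r^4, 0). *)
have [|P3 [Q3 [Q30 FQ3]]] := restrict0 (F := f \o par) fev3 _ QG0 FQ.
  move=> t; apply: (cpar (fun y => (t, y))).
  by rewrite /par /=; apply: cvg_cone; first [exact: cvg_cst | exact: cvg_id].
have [|P2 [Q2 [Q20 FQ2]]] :=
    restrict0 (F := fun t => f (par (t, 0))) fev2 _ Q30 FQ3.
  move=> t; apply: (cpar (fun b => (t, b, 0))).
  by rewrite /par /=; apply: cvg_cone; first [exact: cvg_cst | exact: cvg_id].
have [|P1 [Q1 [Q10 FQ1]]] :=
    restrict0 (F := fun t => f (par (t, 0, 0))) fev1 _ Q20 FQ2.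
  move=> t; apply: (cpar (fun a => (t, a, 0, 0))).
  by rewrite /par /=; apply: cvg_cone; first [exact: cvg_cst | exact: cvg_id
    | by apply: cvgD; [exact: cvg_cst | exact: cvg_id]].
(* The last variable r is kept: only its powers are cancelled, so that the denominator does not
   vanish at r = 0. *)
have [|p' [q' [q'0 Fq']]] :=
    cancelX (F := fun t => f (par (t, 0, 0, 0))) fev0 _ Q10 FQ1.
  move=> t; apply: (cpar (fun r => (t, r, 0, 0, 0))).
  by rewrite /par /=; apply: cvg_cone; first [exact: cvg_cst | exact: cvg_id].
exists p', q'; split=> // u; have := Fq' (tt, u); rewrite !evXE /= !map_poly_id //.
move=> <-; congr (f _ * _); rewrite /par coneE /=; congr vec; ring.
Qed.

(** Adding the identities at u and -u, where u^2 = t, keeps only the even parts of [p] and [q]; the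
    constant coefficient of [q] survives. *)
Lemma R0_arc f : R0 f -> exists p q : {poly R}, q.[0] != 0 /\
  forall t, 0 <= t -> f (vec 0 0 (t ^+ 2) 0) * q.[t] = p.[t].
Proof.
move=> /R0_rational[p [q [q0 fq]]].
exists (even_poly p), (even_poly q); split.
  by rewrite horner_coef0 coef_even_poly -horner_coef0.
move=> t t0; pose u := Num.sqrt t.
have ut : u ^+ 2 = t by exact: sqr_sqrtr.
have u4 : u ^+ 4 = t ^+ 2 by rewrite (exprM _ 2 2) ut.
have evenE (s : {poly R}) : 2 * (even_poly s).[t] = s.[u] + s.[- u].
  rewrite -[in RHS](poly_even_odd s) !(hornerD, horner_comp, hornerXn, hornerMX).
  by rewrite sqrrN ut; ring.
have Nu4 : (- u) ^+ 4 = t ^+ 2 by rewrite (exprM _ 2 2) sqrrN ut.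
have := fq u; have := fq (- u); rewrite Nu4 u4 => e1 e2.
apply: (@mulfI _ 2); first by rewrite pnatr_eq0.
by rewrite mulrCA !evenE mulrDr e2 e1.
Qed.
End Rationality.

(** * Formal power series as coefficient sequences *)

Section PowerSeries.
Variable R : realType.
Implicit Types (a b c : nat -> R) (p q : {poly R}).

Definition coefs p : nat -> R := fun n => p`_n.

Definition conv a b : nat -> R := fun n => \sum_(i < n.+1) a i * b (n - i)%N.

(** Coefficients below [N] depend only on truncations, so the ring laws of [conv] come from those of
    polynomials. *)
Lemma conv_trunc N a b n : (n < N)%N ->
  conv a b n = ((\poly_(i < N) a i) * (\poly_(i < N) b i))`_n.
Proof.
move=> nN; rewrite coefM; apply: eq_bigr => i _.
by rewrite !coef_poly !(leq_ltn_trans _ nN) ?leq_subr// -ltnS.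
Qed.

Lemma convC a b : conv a b = conv b a.
Proof. by apply/funext => n; rewrite !(conv_trunc _ _ (ltnSn n)) mulrC. Qed.

Lemma convA a b c : conv a (conv b c) = conv (conv a b) c.
Proof.
apply/funext => n; transitivity
  (((\poly_(i < n.+1) a i) * ((\poly_(i < n.+1) b i) * (\poly_(i < n.+1) c i)))`_n).
  rewrite coefM; apply: eq_bigr => i _; rewrite coef_poly ltn_ord.
  by rewrite -conv_trunc// ltnS leq_subr.
rewrite mulrA coefM; apply: eq_bigr => i _; rewrite -conv_trunc//.
by rewrite coef_poly ltnS leq_subr.
Qed.

Lemma conv_coefs p q : conv (coefs p) (coefs q) = coefs (p * q).
Proof. by apply/funext => n; rewrite /coefs coefM. Qed.

Lemma convDr a b c : conv a (b \+ c) = conv a b \+ conv a c.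
Proof.
by apply/funext => n; rewrite /conv /= -big_split; apply: eq_bigr => i _; rewrite mulrDr.
Qed.

Lemma convZr a b (k : R) : conv a (k \*o b) = k \*o conv a b.
Proof.
by apply/funext => n; rewrite /conv /= mulr_sumr; apply: eq_bigr => i _; rewrite mulrCA.
Qed.

Lemma conv0 a : conv (fun=> 0) a = fun=> 0.
Proof. by apply/funext => n; apply: big1 => i _; rewrite mul0r. Qed.

(** As [a 0] is invertible, coefficient n of the product determines that of the factor once the
    earlier ones are known. *)
Lemma conv_inj a b c : a 0 != 0 -> conv a b = conv a c -> b = c.
Proof.
move=> a0 abc; apply/funext => n; elim/ltn_ind: n => n IH.
have := congr1 (fun h => h n) abc; rewrite /conv !big_ord_recl subn0.
rewrite (eq_bigr (fun i : 'I_n => a (lift ord0 i) * c (n - lift ord0 i)%N)).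
  by move/addIr/(mulfI a0).
by move=> i _; rewrite IH// lift0; case: n i {IH} => [[]//|n] i; rewrite subSS ltnS leq_subr.
Qed.

Lemma conv_div a b : a 0 != 0 -> exists c, conv a c = b.
Proof.
(* Long division: [shift] subtracts the multiple of [a] that kills the constant term and divides by
   t. The constant term of the n-th remainder, divided by [a 0], is the n-th coefficient of the
   quotient. *)
move=> a0; pose shift (s : nat -> R) n := s n.+1 - s 0 / a 0 * a n.+1.
exists (fun n => iter n shift b 0 / a 0); apply/funext => n; rewrite convC.
elim: n b => [|n IH] b; first by rewrite /conv big_ord1 divfK.
rewrite /conv big_ord_recl /= subn0; have := IH (shift b).
rewrite {1}/conv => IHb.
under eq_bigr => i _ do rewrite subSS -iterS iterSr.
by rewrite IHb /shift addrC subrK.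
Qed.

(** The substitution of e t for t. *)
Definition twist (e : R) a : nat -> R := fun n => e ^+ n * a n.

Lemma conv_twist e a b : conv (twist e a) (twist e b) = twist e (conv a b).
Proof.
apply/funext => n; rewrite /twist /conv mulr_sumr; apply: eq_bigr => i _.
by rewrite mulrACA -exprD subnKC// -ltnS.
Qed.

Lemma twist_coefs e p : exists p', twist e (coefs p) = coefs p'.
Proof.
exists (\poly_(i < size p) (e ^+ i * p`_i)); apply/funext => n.
rewrite /coefs coef_poly; case: ltnP => // np.
by rewrite /twist nth_default// mulr0.
Qed.

(** * Embedding of power series into Puiseux series *)

(** The test is that of [ps_of_poly], so that [emb_coefs] holds by conversion. *)
Definition isnat (r : rat) := (denq r == 1%Z) && (0 <= numq r).

Definition emb a : Defs.series R := fun r => if isnat r then a `|numq r|%N else 0.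

Lemma isnatP r : reflect (exists n : nat, r = n%:R) (isnat r).
Proof.
apply: (iffP andP) => [[/eqP d1 n0]|[n ->]].
  exists `|numq r|%N; rewrite -[LHS]divq_num_den d1 divr1.
  by rewrite [RHS]pmulrn abszE ger0_norm.
by rewrite pmulrn denq_int numq_int.
Qed.

Lemma isnat_nat (n : nat) : isnat n%:R.
Proof. by apply/isnatP; exists n. Qed.

Lemma emb_nat a (n : nat) : emb a n%:R = a n.
Proof. by rewrite /emb isnat_nat pmulrn numq_int. Qed.

Lemma emb_notnat a r : ~~ isnat r -> emb a r = 0.
Proof. by rewrite /emb => /negPf ->. Qed.

Lemma embD a b : ps_add (emb a) (emb b) = emb (a \+ b).
Proof. by apply/funext => r; rewrite /ps_add /emb; case: ifP; rewrite ?addr0. Qed.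

Lemma embZ (k : R) a : ps_scale k (emb a) = emb (k \*o a).
Proof. by apply/funext => r; rewrite /ps_scale /emb; case: ifP; rewrite ?mulr0. Qed.

Lemma emb0 : emb (fun=> 0) = ps_zero R.
Proof. by apply/funext => r; rewrite /emb if_same. Qed.

Lemma emb1 : emb (coefs 1) = ps_one R.
Proof.
apply/funext => r; rewrite /ps_one /ps_const; case: (boolP (isnat r)) => rn.
  by have /isnatP[n ->] := rn; rewrite emb_nat /coefs coef1 pnatr_eq0; case: eqP.
rewrite /emb (negPf rn); case: eqP => // r0; move: rn; rewrite r0.
by rewrite (isnat_nat 0).
Qed.

Lemma emb_coefs p : ps_of_poly p = emb (coefs p).
Proof. by []. Qed.

(** A term contributes only if s and r - s are both natural numbers. This makes r natural and bounds
    s by r, so the sum over all rationals becomes the finite sum of [conv]. *)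
Lemma embM a b : ps_mul (emb a) (emb b) = emb (conv a b).
Proof.
apply/funext => r; rewrite /ps_mul.
have [rn|rn] := boolP (isnat r); last first.
  rewrite fsbig1 ?emb_notnat// => s _.
  have [/isnatP[n sE]|sn] := boolP (isnat s); last by rewrite emb_notnat// mul0r.
  have [/isnatP[m rsE]|rsn] := boolP (isnat (r - s)).
    case/negP: rn; apply/isnatP; exists (m + n)%N.
    by rewrite natrD -rsE -sE subrK.
  by rewrite mulrC emb_notnat// mul0r.
have /isnatP[n rE] := rn; rewrite {}rE {rn}; set F := fun s : rat => _.
have injn : injective (fun i : nat => i%:R : rat).
  by move=> i j /eqP; rewrite eqr_nat => /eqP.
rewrite -(@fsbig_widen _ _ _ _ [set` [seq (i%:R : rat) | i <- iota 0 n.+1]]) //.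
  rewrite -fsbig_seq ?map_inj_uniq ?iota_uniq// big_map.
  rewrite emb_nat /conv -(big_mkord xpredT (fun i => a i * b (n - i)%N)).
  rewrite /index_iota subn0; apply: eq_big_seq => i; rewrite mem_iota ltnS /= => ni.
  by rewrite /F emb_nat -natrB// emb_nat.
move=> s [_ /= sn]; rewrite /F.
have [/isnatP[m sE]|sN] := boolP (isnat s); last by rewrite emb_notnat// mul0r.
have [/isnatP[k rsE]|rsN] := boolP (isnat (n%:R - s)); last first.
  by rewrite mulrC emb_notnat// mul0r.
case: sn; rewrite sE; suff mn : m \in iota 0 n.+1.
  exact: (map_f (fun i : nat => i%:R : rat) mn).
rewrite mem_iota ltnS /=.
have : n%:R = (k + m)%:R :> rat by rewrite natrD -rsE -sE subrK.
by move/injn ->; rewrite leq_addl.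
Qed.

Lemma emb_puiseux a : is_puiseux (emb a).
Proof.
exists 1; split=> // r; rewrite /emb mulr1; case: ifP => [|_]; last by rewrite eqxx.
by move=> /andP[/eqP d1]; rewrite numq_ge0.
Qed.

Lemma emb_alg a p q : q != 0 -> conv (coefs q) a = coefs p -> is_alg (emb a).
Proof.
(* The series is p / q, a root of the linear polynomial q X - p. *)
move=> q0 qa; exists (Poly [:: - p; q]); split.
  by rewrite -size_poly_eq0 (PolyK (c := 0)).
rewrite /ps_horner (PolyK (c := 0))//= !emb_coefs -emb0 !(embM, embD).
rewrite conv0; have -> : coefs q \+ (fun=> 0) = coefs q by apply/funext => n /=; rewrite addr0.
rewrite qa; congr emb; apply/funext => n /=.
by rewrite /coefs coefN addNr.
Qed.

End PowerSeries.

(** * Homomorphisms attached to the arc *)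

Section Arc.
Variable R : realType.
Implicit Types (f g : fnV R) (c d : nat -> R) (p q : {poly R}).

Definition arc (t : R) : pt R := vec 0 0 (t ^+ 2) 0.

Lemma arc_V t : Vset (arc t).
Proof. by rewrite Vset_vec !expr0n /= mulr0. Qed.

(** [c] is the Taylor series at 0 of the rational function p / q that f induces on the arc. Since t
    and -t give the same point, agreement is asked for t >= 0 only; this lets |z|^(1/2) expand as
    t. *)
Definition arc_expansion f c := exists p q, [/\ q.[0] != 0,
  forall t, 0 <= t -> f (arc t) * q.[t] = p.[t] & conv (coefs q) c = coefs p].

Lemma arc_expansion_poly f p : (forall t, 0 <= t -> f (arc t) = p.[t]) ->
  arc_expansion f (coefs p).
Proof.
move=> fp; exists p, 1; split; first by rewrite hornerC oner_eq0.
  by move=> t t0; rewrite hornerC mulr1 fp.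
by rewrite conv_coefs mul1r.
Qed.

Lemma R0_arc_expansion f : R0 f -> exists c, arc_expansion f c.
Proof.
move=> /R0_arc[p [q [q0 fq]]].
have [c qc] := @conv_div R (coefs q) (coefs p) ltac:(by rewrite /coefs -horner_coef0).
by exists c, p, q.
Qed.

Lemma RV_arc f : RV f -> exists p, forall t, f (arc t) = p.[t ^+ 2].
Proof.
move=> [P fP].
pose ev (t : R) : {rmorphism {poly R} -> R} := horner_eval t.
have evk t r : ev t r%:P = r by exact: hornerC.
have [p pE] := mpoly_subst (fun i : 'I_4 => [:: 0; 0; 'X; 0]`_i) P evk.
exists p => t; rewrite fP; last exact: arc_V.
transitivity (ev (t ^+ 2) p); last by [].
rewrite pE; apply: mpoly.meval_eq => i; rewrite /coords mxE.
by case: i => [[|[|[|[|//]]]] h] /=; rewrite ?rmorph0//; exact/esym/hornerX.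
Qed.

(** The two fractions agree for t >= 0, hence as polynomials after cross-multiplication; the product
    of the denominators has nonzero constant term and cancels. *)
Lemma arc_expansion_uniq f g c d : (forall v, Vset v -> f v = g v) ->
  arc_expansion f c -> arc_expansion g d -> c = d.
Proof.
move=> fg [p [q [q0 fp qc]]] [p' [q' [q'0 gp qd]]].
have pq : q' * p = q * p'.
  apply/eqP; rewrite -subr_eq0; apply/eqP; apply: poly_eq0_on_ge0 => t t0.
  by rewrite hornerD hornerN !hornerM -fp// -gp// fg ?subrr; [ring|exact: arc_V].
apply: (@conv_inj R (coefs (q' * q))).
  by rewrite /coefs -horner_coef0 hornerM mulf_neq0.
rewrite -conv_coefs -convA qc (convC (coefs q') (coefs q)) -convA qd.
by rewrite !conv_coefs pq.
Qed.

Lemma arc_expansionD f g c d : arc_expansion f c -> arc_expansion g d ->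
  arc_expansion (fun v => f v + g v) (c \+ d).
Proof.
move=> [p [q [q0 fp qc]]] [p' [q' [q'0 gp qd]]].
exists (q' * p + q * p'), (q' * q); split; first by rewrite hornerM mulf_neq0.
  by move=> t t0; rewrite hornerD !hornerM -fp// -gp//; ring.
rewrite convDr -{1}conv_coefs -convA qc mulrC -conv_coefs -convA qd !conv_coefs.
by apply/funext => n; rewrite /coefs coefD.
Qed.

Lemma arc_expansionM f g c d : arc_expansion f c -> arc_expansion g d ->
  arc_expansion (fun v => f v * g v) (conv c d).
Proof.
move=> [p [q [q0 fp qc]]] [p' [q' [q'0 gp qd]]].
exists (p * p'), (q * q'); split; first by rewrite hornerM mulf_neq0.
  by move=> t t0; rewrite !hornerM -fp// -gp//; ring.
rewrite -!conv_coefs -qc -qd -!convA; congr conv.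
by rewrite !convA; congr conv; exact: convC.
Qed.

Lemma arc_expansionZ (k : R) f c : arc_expansion f c ->
  arc_expansion (fun v => k * f v) (k \*o c).
Proof.
move=> [p [q [q0 fp qc]]]; exists (k *: p), q; split=> //.
  by move=> t t0; rewrite hornerZ -fp// mulrA.
by rewrite convZr qc; apply/funext => n; rewrite /coefs coefZ.
Qed.

(** The default value 0 is taken only by functions without an expansion. *)
Definition arc_coef f : nat -> R := xget (fun=> 0) [set c | arc_expansion f c].

Lemma arc_coefP f c : arc_expansion f c -> arc_coef f = c.
Proof.
move=> fc; have h : arc_expansion f (arc_coef f) by apply: xgetPex; exists c.
exact: (arc_expansion_uniq _ h fc).
Qed.

Definition arc_hom (e : R) f : Defs.series R := emb (twist e (arc_coef f)).

Lemma arc_homE e f c : arc_expansion f c -> arc_hom e f = emb (twist e c).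
Proof. by move=> fc; rewrite /arc_hom (arc_coefP fc). Qed.

(** Stated for a general class [D], to be applied to both [RV] and [R0]. *)
Lemma arc_hom_is_hom (D : fnV R -> Prop) e :
  (forall f, D f -> exists c, arc_expansion f c) -> is_hom_on D (arc_hom e).
Proof.
move=> De; split.
  move=> f /De[c fc]; rewrite (arc_homE _ fc); split; first exact: emb_puiseux.
  have [p [q [q0 _ qc]]] := fc.
  have [p' p'E] := twist_coefs e p; have [q' q'E] := twist_coefs e q.
  apply: (@emb_alg _ _ p' q'); last by rewrite -p'E -q'E conv_twist qc.
  (* Twisting fixes the constant coefficient, so the twisted denominator is still nonzero. *)
  apply: contraNneq q0 => q'0; have := congr1 (fun h => h 0) q'E.
  by rewrite q'0 /twist /coefs coef0 expr0 mul1r horner_coef0 => ->.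
split.
  move=> f g /De[c fc] /De[d gd] fg.
  by rewrite (arc_homE _ fc) (arc_homE _ gd) (arc_expansion_uniq fg fc gd).
split.
  move=> f g /De[c fc] /De[d gd].
  rewrite (arc_homE _ fc) (arc_homE _ gd) (arc_homE _ (arc_expansionD fc gd)) embD.
  by congr emb; apply/funext => n; rewrite /twist /= mulrDr.
split.
  move=> f g /De[c fc] /De[d gd].
  rewrite (arc_homE _ fc) (arc_homE _ gd) (arc_homE _ (arc_expansionM fc gd)) embM.
  by rewrite conv_twist.
split.
  move=> k f /De[c fc].
  rewrite (arc_homE _ fc) (arc_homE _ (arc_expansionZ k fc)) embZ.
  by congr emb; apply/funext => n; rewrite /twist /= mulrCA.
rewrite (arc_homE _ (@arc_expansion_poly (fun=> 1) 1 _)); last first.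
  by move=> t _; rewrite hornerC.
rewrite -emb1; congr emb; apply/funext => n; rewrite /twist /coefs coef1.
by case: n => [|n]; rewrite ?expr0 ?mulr0 ?mul1r.
Qed.

(** Polynomial functions expand in even powers of t, on which the sign (-1)^n is 1. *)
Lemma arc_homN_RV f : RV f -> arc_hom (-1) f = arc_hom 1 f.
Proof.
move=> /RV_arc[p fp].
have fc : arc_expansion f (coefs (p \Po 'X^2)).
  by apply: arc_expansion_poly => t _; rewrite horner_comp hornerXn fp.
rewrite !(arc_homE _ fc); congr emb; apply/funext => n.
rewrite /twist /coefs coef_comp_poly_Xn//; case: ifP => [|_]; last by rewrite !mulr0.
by rewrite dvdn2 -signr_odd => /negPf ->; rewrite expr1n.
Qed.

(** * The continuous rational function |z|^(1/2) *)

Definition root4 (v : pt R) : R := Num.sqrt (Num.sqrt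
  (v ord0 (@Ordinal 4 2 isT) ^+ 2 + v ord0 (@Ordinal 4 3 isT) ^+ 2)).

Lemma root4_arc t : 0 <= t -> root4 (arc t) = t.
Proof.
move=> t0; rewrite /root4 !mxE /= expr0n addr0 sqrtr_sqr ger0_norm ?sqr_ge0//.
by rewrite sqrtr_sqr ger0_norm.
Qed.

(** Continuous on all of R^4 as an iterated square root, and equal to x^2 / y^2 on V where y is
    nonzero, because there (x / y)^8 = z1^2 + z2^2. *)
Lemma R0_root4 : R0 root4.
Proof.
split.
  apply: continuous_subspaceT => v; rewrite /root4.
  have c (i : 'I_4) : (w : pt R) ord0 i @[w --> v] --> v ord0 i.
    exact: coord_continuous.
  have c2 (i : 'I_4) : (w : pt R) ord0 i ^+ 2 @[w --> v] --> v ord0 i ^+ 2.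
    exact: (cvgM (c i) (c i)).
  have sqrt_cvg (h : pt R -> R) :
      h w @[w --> v] --> h v -> Num.sqrt (h w) @[w --> v] --> Num.sqrt (h v).
    by move=> hv; apply: (continuous_comp hv); exact: sqrt_continuous.
  by do 2 apply: (sqrt_cvg _); exact: (cvgD (c2 _) (c2 _)).
pose sqX i := mpoly.mpolyX R (mpoly.mnm_muln (mpoly.mnm1 i) 2) : poly4 R.
have sqXE i v : pev (sqX i) v = v ord0 i ^+ 2.
  rewrite /pev mpoly.mevalX (bigD1 i)//= big1 ?mulr1; last first.
    by move=> j ji; rewrite mpoly.mulmnE mpoly.mnm1E eq_sym (negPf ji) mul0n expr0.
  by rewrite mpoly.mulmnE mpoly.mnm1E eqxx mul1n.
exists [set v : pt R | Vset v /\ has (fun g : poly4 R => pev g v != 0) [:: sqX (@Ordinal 4 1 isT)]].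
split; first by exists [:: sqX (@Ordinal 4 1 isT)].
split.
  (* A point of V with y nonzero. *)
  exists (vec 0 1 0 0); split; first by rewrite Vset_vec !expr0n /= addr0 mul0r.
  by rewrite /= sqXE mxE /= expr1n oner_eq0.
exists (sqX (@Ordinal 4 0 isT)), (sqX (@Ordinal 4 1 isT)).
split=> v [Vv /=]; rewrite orbF // !sqXE => y0.
suff -> : root4 v = Num.sqrt (Num.sqrt
    (((v ord0 (@Ordinal 4 0 isT) / v ord0 (@Ordinal 4 1 isT)) ^+ 2) ^+ 2 ^+ 2)).
  by rewrite sqrtr_sqr ger0_norm ?sqr_ge0// sqrtr_sqr ger0_norm ?sqr_ge0// expr_div_n.
congr (Num.sqrt (Num.sqrt _)); rewrite -!exprM expr_div_n Vv mulfK// expf_neq0//.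
by apply: contraNneq y0 => ->; rewrite expr0n.
Qed.

End Arc.

(** * Failure of uniqueness *)

Theorem theorem4p7 (R : realType) : ~ substitution_property R.
Proof.
move=> /(_ (arc_hom 1)) [].
  apply: arc_hom_is_hom => f /RV_arc[p fp]; exists (coefs (p \Po 'X^2)).
  by apply: arc_expansion_poly => t _; rewrite horner_comp hornerXn fp.
move=> psi [_ _ uniq_psi].
have R0hom e := @arc_hom_is_hom R (@R0 R) e (@R0_arc_expansion R).
(* Both [arc_hom 1] and [arc_hom (-1)] extend the given homomorphism, so uniqueness would make them
   agree at [root4]. *)
have eq1 := uniq_psi _ (R0hom 1) (fun _ _ => erefl) _ (R0_root4 R).
have eqN := uniq_psi _ (R0hom (-1)) (@arc_homN_RV R) _ (R0_root4 R).
have ex : arc_expansion (@root4 R) (coefs 'X).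
  by apply: arc_expansion_poly => t t0; rewrite root4_arc// hornerX.
(* The coefficients of t^1 are -1 and 1. *)
have := congr1 (fun s : Defs.series R => s 1%:R) (etrans eqN (esym eq1)).
rewrite !(arc_homE _ ex) !emb_nat /twist /coefs coefX !mulr1 !expr1 => /eqP.
by rewrite eq_sym -addr_eq0 -(natrD _ 1 1) pnatr_eq0.
Qed.
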